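(* Let $G$ and $H$ be interval colorable graphs, and suppose that $H$ is $r$-regular. Then $$W(G\square H)\geq W(G)+W(H)+r.$$
   Context: All graphs are finite, undirected, without loops or multiple edges. An interval $t$-coloring of a graph $G$ ($t$ a positive integer) is a proper edge-coloring of $G$ with colors $1,\ldots,t$ such that all colors are used and, for each vertex $v$, the set of colors of the edges incident to $v$ is an interval of integers. $G$ is interval colorable if it has an interval $t$-coloring for some positive integer $t$. For an interval colorable graph $G$, $W(G)$ denotes the maximum $t$ for which $G$ has an interval $t$-coloring. The Cartesian product $G\square H$ has vertex set $V(G)\times V(H)$, with $(u_1,v_1)$ and $(u_2,v_2)$ adjacent iff ($u_1=u_2$ and $v_1v_2\in E(H)$) or ($v_1=v_2$ and $u_1u_2\in E(G)$). (If $G$ and $H$ are interval colorable, then so is $G\square H$; this is a known result of Giaro and Kubale.) *)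

(* Defs.v *)
From mathcomp Require Import all_boot.
From mathcomp Require Import boolp.

Set Implicit Arguments.
Unset Strict Implicit.
Unset Printing Implicit Defensive.

Record sgraph := SGraph {
  vertex :> finType;
  adj : rel vertex;
  adj_sym : symmetric adj;
  adj_irrefl : irreflexive adj }.

Definition edges (G : sgraph) : {set {set G}} :=
  [set [set p.1; p.2] | p : G * G & adj p.1 p.2].

Definition degree (G : sgraph) (v : G) : nat := #|[set w | adj v w]|.

Definition regular (G : sgraph) (r : nat) : Prop := forall v : G, degree v = r.

Definition prod_adj (G H : sgraph) : rel (G * H) := fun x y =>
  (x.1 == y.1) && adj x.2 y.2 || (x.2 == y.2) && adj x.1 y.1.

Lemma prod_adj_sym (G H : sgraph) : symmetric (@prod_adj G H).
Proof.
move=> x y; rewrite /prod_adj (eq_sym x.1) (eq_sym x.2).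
by rewrite (adj_sym x.1) (adj_sym x.2).
Qed.

Lemma prod_adj_irrefl (G H : sgraph) : irreflexive (@prod_adj G H).
Proof. by move=> x; rewrite /prod_adj !adj_irrefl !andbF. Qed.

Definition cartesian_product (G H : sgraph) : sgraph :=
  SGraph (@prod_adj_sym G H) (@prod_adj_irrefl G H).

(* Values of [c] outside [edges G] are irrelevant. *)
Definition proper_edge_coloring (G : sgraph) (c : {set G} -> nat) : Prop :=
  forall e f, e \in edges G -> f \in edges G ->
    e != f -> e :&: f != set0 -> c e <> c f.

Definition color_at (G : sgraph) (c : {set G} -> nat) (v : G) (k : nat) : Prop :=
  exists e, [/\ e \in edges G, v \in e & c e = k].

(* The empty set counts as an interval, so isolated vertices are allowed. *)
Definition is_interval (S : nat -> Prop) : Prop :=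
  forall i j k, S i -> S k -> i <= j <= k -> S j.

Definition interval_coloring (G : sgraph) (t : nat) (c : {set G} -> nat) : Prop :=
  [/\ proper_edge_coloring c,
      forall e, e \in edges G -> 1 <= c e <= t,
      forall k, 1 <= k <= t -> exists2 e, e \in edges G & c e = k
    & forall v : G, is_interval (color_at c v)].

Definition has_interval_coloring (G : sgraph) (t : nat) : Prop :=
  0 < t /\ exists c : {set G} -> nat, interval_coloring t c.

Definition interval_colorable (G : sgraph) : Prop :=
  exists t, has_interval_coloring G t.

(* All [t] colors being used, [t] is at most the number of edges; hence the
   bounded maximum below is the maximum over all [t], see [leq_W] and
   [W_attained]. It is 0 when [G] is not interval colorable. *)
Definition W (G : sgraph) : nat :=
  \max_(t < #|edges G|.+1 | `[< has_interval_coloring G t >]) t.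

Lemma has_interval_coloring_leq (G : sgraph) (t : nat) :
  has_interval_coloring G t -> t <= #|edges G|.
Proof.
case=> _ [c [_ _ used _]].
rewrite -(size_iota 1 t) cardE -(size_map c).
apply: uniq_leq_size; first exact: iota_uniq.
move=> k; rewrite mem_iota add1n ltnS => /used[e eG <-].
by apply: map_f; rewrite mem_enum.
Qed.

Lemma leq_W (G : sgraph) (t : nat) : has_interval_coloring G t -> t <= W G.
Proof.
move=> Gt; have tE : t < #|edges G|.+1 by exact: has_interval_coloring_leq.
by apply: (@leq_bigmax_cond _ _ _ (Ordinal tE)); apply/asboolP.
Qed.

Lemma W_attained (G : sgraph) :
  interval_colorable G -> has_interval_coloring G (W G).
Proof.
case=> t Gt; have tE : t < #|edges G|.+1 by exact: has_interval_coloring_leq.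
have /asboolP Pt := Gt.
by rewrite /W (bigmax_eq_arg (Ordinal tE)) //; case: arg_maxnP => // i /asboolP.
Qed.

(* Main.v *)
Require Import Defs.
From mathcomp Require Import all_boot.
From mathcomp Require Import zify.

(** Let [f] be an interval coloring of [G] with [s = W G] colors and [g] one of
    [H] with [t = W H] colors. Since [H] is [r]-regular, the colors at each
    vertex [v] of [H] are exactly the [r] integers of [(m v, m v + r]]; those at
    a vertex [u] of [G] are the integers of some [(a u, b u]]. Color the copy of
    [G] over [v] by [f + m v], so that the [G]-edges at [(u, v)] occupy
    [(a u + m v, b u + m v]]. The copy of [H] over [u] may now be placed in
    two ways: [g + b u] occupies [(b u + m v, b u + m v + r]] at [(u, v)],
    immediately above the [G]-edges, while [g + a u - r] occupies
    [(a u + m v - r, a u + m v]], immediately below them. In both cases the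
    colors at [(u, v)] form an interval, whatever [v] is, so the choice between
    above and below is free and independent for each [u].

    Put one copy of [H] below, over a vertex [u0] that sees the color 1, and all
    others above, among them one over a vertex [u1 != u0] that sees the color
    [s]. Such vertices exist because an edge has two ends. The colors used then
    run from [1 - r], over [u0], to [s + t], over [u1], which makes [s + t + r]
    of them. There is no gap: the copy over [u0] covers [1 - r, ..., 0] because
    [r <= t], a copy of [G] over a vertex with [m v = 0] covers [1, ..., s], and
    the copy over [u1] covers the rest. Below, everything is shifted by [r] to
    remain in the positive integers; see [product_arc_coloring]. *)

Set Implicit Arguments.
Unset Strict Implicit.
Unset Printing Implicit Defensive.

(** * Edge colorings as functions of the two ends of an edge *)

Definition seen (G : sgraph) (f : G -> G -> nat) (x : G) (k : nat) : Prop :=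
  exists2 y, adj x y & f x y = k.

(** An interval coloring read as a function of two adjacent vertices, which spares
    the unordered pairs when edges of a product are built. *)
Definition arc_coloring (G : sgraph) (t : nat) (f : G -> G -> nat) : Prop :=
  [/\ forall x y, adj x y -> f x y = f y x,
      forall x y z, adj x y -> adj x z -> f x y = f x z -> y = z,
      forall x y, adj x y -> 1 <= f x y <= t,
      forall k, 1 <= k <= t -> exists x, seen f x k
    & forall x, is_interval (seen f x)].

Lemma edgesP (G : sgraph) (e : {set G}) :
  reflect (exists x, exists2 y, adj x y & e = [set x; y]) (e \in edges G).
Proof.
apply: (iffP imsetP) => [[[x y]]|[x [y xy ->]]]; last by exists (x, y); rewrite ?inE.
by rewrite inE => xy ->; exists x, y.
Qed.

Lemma edge_in (G : sgraph) (x y : G) : adj x y -> [set x; y] \in edges G.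
Proof. by move=> xy; apply/edgesP; exists x, y. Qed.

Lemma adj_neq (G : sgraph) (x y : G) : adj x y -> x != y.
Proof. by apply: contraTneq => ->; rewrite adj_irrefl. Qed.

Lemma edge_at (G : sgraph) (e : {set G}) (x : G) :
  e \in edges G -> x \in e -> exists2 y, adj x y & e = [set x; y].
Proof.
case/edgesP=> a [b ab ->]; rewrite in_set2 => /orP[]/eqP->; first by exists b.
by exists a; rewrite 1?adj_sym // setUC.
Qed.

Lemma arc_coloring_of_interval (G : sgraph) (t : nat) (c : {set G} -> nat) :
  interval_coloring t c -> arc_coloring t (fun x y => c [set x; y]).
Proof.
case=> proper range used itv.
have seenP x k : seen (fun x y => c [set x; y]) x k <-> color_at c x k.
  split=> [[y xy <-]|[e [eG xe <-]]].
    by exists [set x; y]; split; [exact: edge_in | rewrite set21 |].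
  by have [y xy ->] := edge_at eG xe; exists y.
split=> [x y _|x y z xy xz|x y xy|k kt|x i j k].
- by rewrite setUC.
- move=> cyz; apply/eqP/negPn/negP => yz.
  apply: (proper _ _ (edge_in xy) (edge_in xz) _ _ cyz); last first.
    by apply/set0Pn; exists x; rewrite in_setI !set21.
  apply/eqP => /setP/(_ y).
  by rewrite set22 in_set2 (negPf yz) eq_sym (negPf (adj_neq xy)).
- exact/range/edge_in.
- by have [e /edgesP[x [y xy ->]] <-] := used _ kt; exists x, y.
- by move=> /seenP ci /seenP ck ijk; apply/seenP; exact: itv ci ck ijk.
Qed.

Lemma interval_of_arc_coloring (G : sgraph) (t : nat) (f : G -> G -> nat) :
  arc_coloring t f -> exists c : {set G} -> nat, interval_coloring t c.
Proof.
case=> sym inj range used itv.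
pose c (e : {set G}) :=
  if [pick p : G * G | adj p.1 p.2 && (e == [set p.1; p.2])] is Some p
  then f p.1 p.2 else 0.
have cE x y : adj x y -> c [set x; y] = f x y.
  move=> xy; rewrite /c; case: pickP => [[a b]|/(_ (x, y))] /=; last first.
    by rewrite xy eqxx.
  case/andP=> ab /eqP/setP eab.
  have := eab x; have := eab y; rewrite !in_set2 !eqxx orbT /=.
  have xDy := adj_neq xy.
  case: (eqVneq x a) => [<-|_]; case: (eqVneq y b) => [<-|_] //=.
  - by rewrite orbF eq_sym (negPf xDy).
  - by rewrite (negPf xDy).
  - rewrite orbF => /esym/eqP <- /esym/eqP <-.
    by apply: sym; rewrite adj_sym.
have seenP x k : color_at c x k <-> seen f x k.
  split=> [[e [eG xe <-]]|[y xy <-]].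
    by have [y xy ->] := edge_at eG xe; exists y; rewrite ?cE.
  by exists [set x; y]; rewrite cE // set21; split=> //; exact: edge_in.
exists c; split.
- move=> e1 e2 e1G e2G /eqP e12 /set0Pn[x]; rewrite in_setI => /andP[xe1 xe2].
  have [y xy e1E] := edge_at e1G xe1; have [z xz e2E] := edge_at e2G xe2.
  rewrite e1E e2E !cE // => /(inj _ _ _ xy xz) yz.
  by apply: e12; rewrite e1E e2E yz.
- by move=> e /edgesP[x [y xy ->]]; rewrite cE //; exact: range.
- move=> k /used[x [y xy <-]].
  by exists [set x; y]; [exact: edge_in | exact: cE].
- by move=> x i j k /seenP ci /seenP ck ijk; apply/seenP; exact: itv ci ck ijk.
Qed.

(** * The colors at a vertex *)

Definition top (G : sgraph) (f : G -> G -> nat) (x : G) : nat :=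
  \max_(y | adj x y) f x y.

Lemma top_leq (G : sgraph) (t : nat) (f : G -> G -> nat) (x : G) :
  arc_coloring t f -> top f x <= t.
Proof. by case=> _ _ range _ _; apply/bigmax_leqP => y /range/andP[]. Qed.

Lemma seen_top (G : sgraph) (f : G -> G -> nat) (x : G) (k : nat) :
  seen f x k -> seen f x (top f x).
Proof.
by case=> y xy _; rewrite /top (bigmax_eq_arg y) //; case: arg_maxnP => // z xz _; exists z.
Qed.

Lemma leq_top (G : sgraph) (f : G -> G -> nat) (x : G) (k : nat) :
  seen f x k -> k <= top f x.
Proof. by case=> y xy <-; exact: leq_bigmax_cond. Qed.

(** The colors at [x] are pairwise distinct, so they are as many as the
    neighbors of [x]. *)
Lemma degree_seen (G : sgraph) (t : nat) (f : G -> G -> nat) (x : G) :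
  arc_coloring t f -> exists s : seq nat,
  [/\ uniq s, size s = degree x & forall k, k \in s <-> seen f x k].
Proof.
case=> _ inj _ _ _; exists [seq f x y | y in adj x]; split.
- rewrite map_inj_in_uniq ?enum_uniq // => y z.
  by rewrite !mem_enum; exact: inj.
- by rewrite size_map -cardE /degree cardsE.
- move=> k; split=> [/imageP[y xy ->]|[y xy <-]]; first by exists y.
  by apply/imageP; exists y.
Qed.

Lemma degree_leq_top (G : sgraph) (t : nat) (f : G -> G -> nat) (x : G) :
  arc_coloring t f -> degree x <= top f x.
Proof.
move=> ft; have [s [us <- sP]] := degree_seen x ft.
have [_ _ range _ _] := ft.
rewrite -[leqRHS](size_iota 1); apply: uniq_leq_size => // k /sP sk.
rewrite mem_iota; have := leq_top sk.
by case: sk => y /range + <-; lia.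
Qed.

(** Being an interval with [degree x] elements and maximum [top f x], the set of
    colors at [x] is determined by these two numbers. *)
Lemma seenE (G : sgraph) (t : nat) (f : G -> G -> nat) (x : G) (k : nat) :
  arc_coloring t f -> seen f x k <-> top f x - degree x < k <= top f x.
Proof.
move=> ft; have dt := degree_leq_top x ft.
have [s [us ss sP]] := degree_seen x ft; have [_ _ range _ itv] := ft.
split=> [sk|kt].
  rewrite (leq_top sk) andbT.
  have : size (iota k (top f x - k).+1) <= size s.
    apply: uniq_leq_size (iota_uniq _ _) _ => j; rewrite mem_iota => jk.
    have := leq_top sk => kt; apply/sP; apply: (itv x k j _ sk (seen_top sk)); lia.
  by rewrite size_iota ss; have := leq_top sk; lia.
have [/sP//|kNs] := boolP (k \in s).
(* If [k] were not seen, all colors at [x] would lie above it: too few places. *)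
have : size s <= size (iota k.+1 (top f x - k)).
  apply: uniq_leq_size => // j /sP sj; rewrite mem_iota.
  have := leq_top sj; case: (ltnP k j) => [|jk]; first by lia.
  case/negP: kNs; apply/sP; apply: (itv x j k _ sj (seen_top sj)); lia.
by rewrite size_iota ss; lia.
Qed.

(** * The coloring of the product *)

(** All colors are raised by [r] to stay positive, so that the copy of [H] over
    [u0], placed below the [G]-edges, keeps the colors of [g]. In [top g v - r]
    one recognizes the lower end [m v] of the colors [(m v, m v + r]] at [v]. *)
Definition product_coloring (G H : sgraph) (r : nat) (u0 : G)
    (f : G -> G -> nat) (g : H -> H -> nat) (x y : cartesian_product G H) : nat :=
  if x.1 == y.1 then
    g x.2 y.2 + (if x.1 == u0 then 0 else top f x.1 + r)
  else f x.1 y.1 + (top g x.2 - r) + r.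

Lemma product_coloringH (G H : sgraph) (r : nat) (u0 : G)
    (f : G -> G -> nat) (g : H -> H -> nat) (u : G) (v w : H) :
  product_coloring r u0 f g (u, v) (u, w) =
  g v w + (if u == u0 then 0 else top f u + r).
Proof. by rewrite /product_coloring /= eqxx. Qed.

Lemma product_coloringG (G H : sgraph) (r : nat) (u0 : G)
    (f : G -> G -> nat) (g : H -> H -> nat) (u w : G) (v : H) : adj u w ->
  product_coloring r u0 f g (u, v) (w, v) = f u w + (top g v - r) + r.
Proof. by move=> uw; rewrite /product_coloring /= (negPf (adj_neq uw)). Qed.

Variant product_arc_spec (G H : sgraph) (u : G) (v : H) :
    cartesian_product G H -> Prop :=
  | ProductArcH w of adj v w : product_arc_spec u v (u, w)
  | ProductArcG w of adj u w : product_arc_spec u v (w, v).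

Lemma product_arcP (G H : sgraph) (u : G) (v : H) (y : cartesian_product G H) :
  @adj (cartesian_product G H) (u, v) y -> product_arc_spec u v y.
Proof. by case: y => a b /orP[]/andP[/=/eqP<-]; constructor. Qed.

Lemma product_adjH (G H : sgraph) (u : G) (v w : H) :
  adj v w -> @adj (cartesian_product G H) (u, v) (u, w).
Proof. by move=> vw; rewrite /= /prod_adj /= eqxx vw. Qed.

Lemma product_adjG (G H : sgraph) (u w : G) (v : H) :
  adj u w -> @adj (cartesian_product G H) (u, v) (w, v).
Proof. by move=> uw; rewrite /= /prod_adj /= eqxx uw orbT. Qed.

(** The colors at [(u, v)] are those of a translate of the colors at [u] and of
    a translate of the colors at [v]. *)
Lemma seen_product (G H : sgraph) (r : nat) (u0 : G)
    (f : G -> G -> nat) (g : H -> H -> nat) (u : G) (v : H) (k : nat) :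
  @seen (cartesian_product G H) (product_coloring r u0 f g) (u, v) k <->
  (exists2 i, seen g v i & k = i + (if u == u0 then 0 else top f u + r)) \/
  (exists2 i, seen f u i & k = i + (top g v - r) + r).
Proof.
split=> [[_ /product_arcP[w vw|w uw] <-]|[[_ [w vw <-] ->]|[_ [w uw <-] ->]]].
- by left; exists (g v w); [exists w | exact: product_coloringH].
- by right; exists (f u w); [exists w | exact: product_coloringG].
- by exists (u, w); [exact: product_adjH | exact: product_coloringH].
- by exists (w, v); [exact: product_adjG | exact: product_coloringG].
Qed.

(** At [(u, v)] the colors of the [G]-edges and those of the [H]-edges fill two
    consecutive intervals. For [u = u0] this needs that the colors at [u0] start
    from 1. *)
Lemma product_arc_coloring (G H : sgraph) (r s t : nat)
    (f : G -> G -> nat) (g : H -> H -> nat) (u0 u1 : G) (v0 : H) :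
  arc_coloring s f -> arc_coloring t g -> regular H r ->
  seen f u0 1 -> seen f u1 s -> u0 != u1 -> seen g v0 1 ->
  @arc_coloring (cartesian_product G H) (s + t + r) (product_coloring r u0 f g).
Proof.
move=> fs gt Hr f1 fS u01 g1.
have [symf injf rangef usedf _] := fs; have [symg injg rangeg usedg _] := gt.
have topf x : degree x <= top f x <= s.
  by rewrite (degree_leq_top x fs) (top_leq x fs).
have topg v : r <= top g v <= t.
  by rewrite -{1}(Hr v) (degree_leq_top v gt) (top_leq v gt).
have seenf x k := seenE x k fs.
have seeng v k : seen g v k <-> top g v - r < k <= top g v.
  by rewrite -(Hr v); exact: seenE gt.
have topu1 : top f u1 = s.
  by have := leq_top fS; have := topf u1; lia.
have disjoint_colors (u w : G) (v z : H) : adj u w -> adj v z ->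
    g v z + (if u == u0 then 0 else top f u + r) <> f u w + (top g v - r) + r.
  move=> uw vz.
  have /seenf : seen f u (f u w) by exists w.
  have /seeng : seen g v (g v z) by exists z.
  have := topf u; have := topg v; case: (u =P u0) => [->|_]; last by lia.
  by move/seenf: f1; lia.
split.
- move=> [u v] _ /product_arcP[w vw|w uw].
    by rewrite !product_coloringH symg.
  by rewrite !product_coloringG 1?(symf _ _ uw) // adj_sym.
- move=> [u v] _ _ /product_arcP[w vw|w uw] /product_arcP[z vz|z uz].
  + by rewrite !product_coloringH => /addIn/(injg _ _ _ vw vz)->.
  + by rewrite product_coloringH product_coloringG // => /(disjoint_colors _ _ _ _ uz vw).
  + rewrite product_coloringH product_coloringG // => /esym.
    by move=> /(disjoint_colors _ _ _ _ uw vz).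
  + by rewrite !product_coloringG // => /addIn/addIn/(injf _ _ _ uw uz)->.
- move=> [u v] _ /product_arcP[w vw|w uw].
    rewrite product_coloringH; have := rangeg _ _ vw; have := topf u.
    by case: ifP => _; lia.
  by rewrite product_coloringG //; have := rangef _ _ uw; have := topg v; lia.
- move=> k kst; have [kr|rk] := leqP k r.
    have [|v gv] := usedg k; first by have := topg v0; lia.
    by exists (u0, v); apply/seen_product; left; exists k; rewrite ?eqxx ?addn0.
  have [ks|sk] := leqP k (r + s).
    have [|u fu] := usedf (k - r); first by lia.
    exists (u, v0); apply/seen_product; right; exists (k - r) => //.
    by move/seeng: g1; lia.
  have [|v gv] := usedg (k - (s + r)); first by lia.
  exists (u1, v); apply/seen_product; left; exists (k - (s + r)) => //.
  by rewrite eq_sym (negPf u01) topu1; lia.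
- move=> [u v].
  pose lo := if u == u0 then top g v - r else top f u - degree u + top g v.
  have spectrum k :
      @seen (cartesian_product G H) (product_coloring r u0 f g) (u, v) k <->
      lo < k <= lo + degree u + r.
    apply: (iff_trans (seen_product _ _ _ _ _ _ _)).
    have := topf u; have := topg v; rewrite /lo.
    case: (u =P u0) => [->|_] tg tf; last first.
      split=> [[[i /seeng + ->]|[i /seenf + ->]]|lohi]; [lia | lia |].
      have [kG|Gk] := leqP k (top f u + top g v).
        by right; exists (k - top g v); [apply/seenf; lia | lia].
      by left; exists (k - (top f u + r)); [apply/seeng; lia | lia].
    move/seenf: f1 => f1.
    split=> [[[i /seeng + ->]|[i /seenf + ->]]|lohi]; [lia | lia |].
    have [kH|Hk] := leqP k (top g v).
      by left; exists k; [apply/seeng; lia | lia].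
    by right; exists (k - top g v); [apply/seenf; lia | lia].
  by move=> i j k /spectrum si /spectrum sk ijk; apply/spectrum; lia.
Qed.

Theorem theorem4p1 (G H : sgraph) (r : nat) :
  interval_colorable G ->
  interval_colorable H ->
  regular H r ->
  W G + W H + r <= W (cartesian_product G H).
Proof.
move=> /W_attained[s_gt0 [c /arc_coloring_of_interval fs]].
move=> /W_attained[t_gt0 [d /arc_coloring_of_interval gt]] Hr.
set f := (fun x y : G => _) in fs; set g := (fun x y : H => _) in gt.
have [symf _ _ usedf _] := fs; have [_ _ _ usedg _] := gt.
have [|v0 g1] := usedg 1; first by lia.
have [|u1 fS] := usedf (W G); first by lia.
(* One of the two ends of an edge of color 1 differs from [u1]. *)
have [u0 f1 u01] : exists2 u0, seen f u0 1 & u0 != u1.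
  have [|x [y xy fxy]] := usedf 1; first by lia.
  have [xu1|xNu1] := eqVneq x u1; last by exists x => //; exists y.
  exists y; last by rewrite -xu1 eq_sym adj_neq.
  by exists x; rewrite 1?adj_sym // -symf.
apply: leq_W; split; first by lia.
exact/interval_of_arc_coloring/(product_arc_coloring fs gt Hr f1 fS u01 g1).
Qed.
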